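(* Let $m\geq 2$ be an integer. Then both $P_{m,1}$ and $P_{m,2}$ are $2$-special polynomials.
   Context: Let $f_c(z)=z^2+c$ and define $a_i\in\mathbb{Z}[c]$ by $a_1=c$, $a_{i+1}=a_i^2+c$, $a_0=0$. For $m\geq2$, $n\geq1$ the Misiurewicz polynomial is $G_{m,n}(c)=\prod_{k\mid n}\big(a_{m+k-1}+a_{m-1}\big)^{\mu(n/k)}\cdot\epsilon$, where $\epsilon=\prod_{k\mid n}a_k^{-\mu(n/k)}$ if $n\mid m-1$ and $\epsilon=1$ otherwise ($\mu$ the Möbius function); it is monic in $\mathbb{Z}[c]$. For a root $\alpha$ of $G_{m,n}$, $\lambda_{m,n}(\alpha)=2^n\prod_{i=0}^{n-1}a_{m+i}(\alpha)$ is the multiplier of the $n$-cycle $\{a_m(\alpha),\dots,a_{m+n-1}(\alpha)\}$ of $f_\alpha$, and $P_{m,n}(x)=\prod_{j}(x-\lambda_{m,n}(c_j))\in\mathbb{Z}[x]$, the product over the roots $c_j$ of $G_{m,n}$. A monic $P(x)=x^i+A_{i-1}x^{i-1}+\dots+A_0\in\mathbb{Z}[x]$ is $2$-special if $v_2(A_{i-1})\geq 2$ and $v_2(A_j)>v_2(A_{i-1})$ for $j=0,\dots,i-2$ (with $v_2(0)=+\infty$). *)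

(* Defs.v *)
From HB Require Import structures.
From Stdlib Require Import ClassicalEpsilon.
From mathcomp Require Import all_boot all_order all_algebra all_field.
Set Implicit Arguments.
Unset Strict Implicit.
Unset Printing Implicit Defensive.
Import Order.TTheory GRing.Theory Num.Theory.
Local Open Scope ring_scope.

Definition mobius (n : nat) : int :=
  if all (fun p => logn p n == 1%N) (primes n) then (-1) ^+ size (primes n)
  else 0.

(* The variable 'X plays the role of the parameter c. *)
Fixpoint crit_orbit (i : nat) : {poly int} :=
  if i is j.+1 then crit_orbit j ^+ 2 + 'X else 0.

Local Notation a := crit_orbit.
Local Notation "p %:F" := (@FracField.tofrac {poly int} p).
Local Notation toC p := (map_poly (intr : int -> algC) p).

(* The Moebius products, computed in the field of fractions of Z[c]; the
   exponents are integers (exprz). *)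
Definition misiurewicz_eps (m n : nat) : {fraction {poly int}} :=
  if (n %| m.-1)%N then \prod_(k <- divisors n) (a k)%:F ^ (- mobius (n %/ k))
  else 1.

Definition misiurewicz_frac (m n : nat) : {fraction {poly int}} :=
  (\prod_(k <- divisors n)
      (a (m + k).-1 + a m.-1)%:F ^ mobius (n %/ k)) * misiurewicz_eps m n.

(* G_{m,n}: the polynomial in Z[c] equal to the fraction above, which is unique
   when it exists because Z[c] embeds in its field of fractions. *)
Definition misiurewicz (m n : nat) : {poly int} :=
  epsilon (inhabits 0) (fun G => G%:F = misiurewicz_frac m n).

(* The roots in algC, listed with multiplicity. *)
Definition roots_seq (p : {poly algC}) : seq algC :=
  sval (closed_field_poly_normal p).

Definition multiplier (m n : nat) (alpha : algC) : algC :=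
  2 ^+ n * \prod_(i < n) (toC (a (m + i))).[alpha].

Definition multiplier_polyC (m n : nat) : {poly algC} :=
  \prod_(c <- roots_seq (toC (misiurewicz m n))) ('X - (multiplier m n c)%:P).

(* P_{m,n}: the unique preimage in Z[x] of the product above. *)
Definition multiplier_poly (m n : nat) : {poly int} :=
  epsilon (inhabits 0) (fun P => toC P = multiplier_polyC m n).

(* 2-adic valuation of an integer; None stands for +oo. *)
Definition v2 (z : int) : option nat :=
  if z == 0 then None else Some (logn 2 `|z|).

Definition val_le (x y : option nat) : bool :=
  match x, y with
  | _, None => true
  | None, Some _ => false
  | Some s, Some t => (s <= t)%N
  end.

Definition val_lt (x y : option nat) : bool := ~~ val_le y x.

(* deg P = i.+1, so that the coefficient A_{deg P - 1} exists and is P`_i. *)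
Definition two_special (P : {poly int}) : Prop :=
  exists i : nat,
    [/\ P \is monic,
        size P = i.+2,
        val_le (Some 2) (v2 P`_i)
      & forall j : nat, (j < i)%N -> val_lt (v2 P`_i) (v2 P`_j)].

(* Main.v *)
(** Write [A = a_(m-1)].

    [n = 2]: here [G_(m,2)] is [A^2 - A + c + 1], divided by [c + 1] when [m] is
    odd, and the multiplier of a 2-cycle of [z^2 + c] is [4 (c + 1)], so that
    [P_(m,2)] is an affine rescaling of [G_(m,2)].

    [n = 1]: at a root [c] of [c G_(m,1) = a_m + a_(m-1)] the number [x = a_m(c)]
    is a fixed point, [c = x - x^2].  Hence the monic [S] with roots the [x]'s
    satisfies [S(X) S(1-X) = T(X) T(1-X)] with [T = A(X - X^2) + X].  A common
    root of [S] and [T(1-X)] would force [x = 1/2], [c = 1/4] and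
    [A(1/4) = -1/2], which is impossible since [A] has nonnegative coefficients.
    So [S = T] up to sign, and [P_(m,1)] is a rescaling of [T / X].

    In both cases the rescaled orbit [D_(i+1) = D_i^2 + 4^(2^(i+1) - 1) L]
    satisfies [D_i = X^n (X - 2^(i+1))] modulo [2^(i+2)] for [i >= 1], because
    squaring doubles the subleading term.  This yields
    [P = X^(d-1) (X - 2^e)] modulo [2^(e+1)] with [e >= 2]. *)

From Stdlib Require Import ClassicalEpsilon.
Require Import Defs.
From mathcomp Require Import all_boot all_order all_algebra all_field.
From mathcomp Require Import ring zify.
Import Order.TTheory GRing.Theory Num.Theory.

Section MultiplierPolynomials.

Local Open Scope ring_scope.

Local Notation a := crit_orbit.
Local Notation "p %:F" := (@FracField.tofrac {poly int} p).
Local Notation toC p := (map_poly (intr : int -> algC) p).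
Local Arguments crit_orbit : simpl never.

(** * Degree, leading coefficient and special values of the critical orbit *)

Lemma crit_orbitS i : a i.+1 = a i ^+ 2 + 'X.
Proof. by []. Qed.

Lemma crit_orbit1 : a 1 = 'X.
Proof. by rewrite crit_orbitS expr0n add0r. Qed.

Lemma size_crit_orbit_monic i :
  size (a i.+1) = (2 ^ i).+1 /\ a i.+1 \is monic.
Proof.
elim: i => [|i [IHs IHm]]; first by rewrite crit_orbit1 size_polyX monicX.
have s2 : size (a i.+1 ^+ 2) = (2 ^ i.+1).+1.
  rewrite expr2 size_monicM ?monic_neq0 // IHs addSn addnS /= addnn -mul2n.
  by rewrite expnS.
have ltX : (size ('X : {poly int}) < size (a i.+1 ^+ 2))%N.
  by rewrite s2 size_polyX ltnS expnS; have := expn_gt0 2 i; lia.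
rewrite crit_orbitS monicE lead_coefDl // size_polyDl // s2; split=> //.
by rewrite -monicE rpredX.
Qed.

Lemma crit_orbit_root0 i : (a i).[0] = 0.
Proof.
elim: i => [|i IHi]; first by rewrite horner0.
by rewrite crit_orbitS !hornerE IHi expr0n.
Qed.

(** At c = -1 the critical orbit alternates between 0 and -1. This is the source of the factor c + 1
    removed when n = 2. *)
Lemma crit_orbit_rootN1 i : (a i).[-1] = - (odd i)%:R.
Proof.
elim: i => [|i IHi]; first by rewrite horner0 oppr0.
by rewrite crit_orbitS !hornerE IHi /=; case: (odd i).
Qed.

(** * Passage to algebraic numbers and elimination of the [epsilon] definitions *)

Lemma toC_inj (p q : {poly int}) : toC p = toC q -> p = q.
Proof. by apply: map_inj_poly => //; apply: intr_inj. Qed.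

Lemma size_toC (p : {poly int}) : size (toC p) = size p.
Proof. by rewrite size_map_inj_poly //; apply: intr_inj. Qed.

Lemma toC_monic (p : {poly int}) : (toC p \is monic) = (p \is monic).
Proof.
rewrite !monicE lead_coef_map_inj //; last exact: intr_inj.
by rewrite -(inj_eq (@intr_inj algC)).
Qed.

Lemma toC_comp (p q : {poly int}) : toC (p \Po q) = toC p \Po toC q.
Proof. exact: map_comp_poly. Qed.

Lemma toC_crit_orbitS i : toC (a i.+1) = toC (a i) ^+ 2 + 'X.
Proof. by rewrite crit_orbitS rmorphD rmorphXn /= map_polyX. Qed.

Lemma horner_crit_orbitS i x :
  (toC (a i.+1)).[x] = (toC (a i)).[x] ^+ 2 + x.
Proof. by rewrite toC_crit_orbitS !hornerE. Qed.

Lemma toC_crit_orbit_ge0 i x : 0 <= x -> 0 <= (toC (a i)).[x].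
Proof.
move=> x0; elim: i => [|i IHi]; first by rewrite rmorph0 horner0.
by rewrite horner_crit_orbitS addr_ge0 // exprn_ge0.
Qed.

Lemma roots_seqE (G : {poly int}) : G \is monic ->
  toC G = \prod_(c <- roots_seq (toC G)) ('X - c%:P).
Proof.
rewrite -toC_monic /roots_seq => mG.
by case: closed_field_poly_normal => r /= {1}->; rewrite (monicP mG) scale1r.
Qed.

Lemma misiurewiczE m n (G : {poly int}) :
  G%:F = misiurewicz_frac m n -> misiurewicz m n = G.
Proof.
move=> eG; apply/eqP; rewrite -tofrac_eq eG; apply/eqP.
exact: (epsilon_spec (inhabits 0)
  (fun H : {poly int} => H%:F = _) (ex_intro _ G eG)).
Qed.

Lemma multiplier_polyE m n (P : {poly int}) :
  toC P = multiplier_polyC m n -> multiplier_poly m n = P.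
Proof.
move=> eP; apply: toC_inj; rewrite eP.
exact: (epsilon_spec (inhabits 0)
  (fun Q : {poly int} => toC Q = _) (ex_intro _ P eP)).
Qed.

(** The substitution X -> sX + t is invertible, so both sides may be compared after it. This passes
    from the polynomial with roots [h c] to the one whose roots are affine images of them, as
    multipliers will be. *)
Lemma prod_XsubC_affine (I : Type) (rs : seq I) (h : I -> algC) (s t : algC)
    (p : {poly algC}) : s != 0 ->
  p \Po (s *: 'X + t%:P) =
    s ^+ size rs *: \prod_(c <- rs) ('X - (h c)%:P) ->
  \prod_(c <- rs) ('X - (s * h c + t)%:P) = p.
Proof.
move=> s0 ep.
set q := LHS.
have eq : q \Po (s *: 'X + t%:P) = p \Po (s *: 'X + t%:P).
  rewrite ep /q {ep q}; elim: rs => [|c rs IHrs].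
    by rewrite !big_nil comp_polyC scale1r.
  rewrite !big_cons comp_polyM IHrs comp_polyB comp_polyX comp_polyC -!mul_polyC.
  rewrite exprS !polyCM polyCD polyCM.
  ring.
have inv : (s *: 'X + t%:P) \Po (s^-1 *: ('X - t%:P)) = 'X.
  rewrite comp_polyD comp_polyZ comp_polyX comp_polyC scalerA divff //.
  by rewrite scale1r subrK.
by rewrite -[q]comp_polyXr -inv comp_polyA eq -comp_polyA inv comp_polyXr.
Qed.

(** * The congruence criterion for being 2-special *)

Lemma logn2_oddM e (x : int) : logn 2 `|(2 ^+ e * (2 * x - 1))%R| = e.
Proof.
rewrite abszM lognM ?absz_gt0; [|by rewrite expf_neq0|by lia].
rewrite abszX pfactorK // [logn 2 `|(2 * x - 1)%R|]logn_coprime ?addn0 //.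
by rewrite coprime2n; lia.
Qed.

(** The coefficient below the leading one is 2^e times the odd number 2 E_n - 1, hence has valuation
    exactly e, and all lower ones are divisible by 2^(e+1). The factor X^s only shifts indices; it
    allows for a root 0 that has been divided out. *)
Lemma two_special_cong (P E : {poly int}) s n e :
  P \is monic -> size ('X^s * P) = n.+2 -> (s <= n)%N -> (2 <= e)%N ->
  'X^s * P = 'X^n * ('X - 2 ^+ e) + 2 ^+ e.+1 * E -> two_special P.
Proof.
move=> mP szP sn e2 eP.
have sz : size P = (n - s).+2.
  by move: szP; rewrite size_monicM ?monicXn ?monic_neq0 // size_polyXn; lia.
have cE j : P`_j = ('X^n * ('X - 2 ^+ e) + 2 ^+ e.+1 * E)`_(s + j).
  by rewrite -eP coefXnM ltnNge leq_addr /= addKn.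
have c2 k (q : {poly int}) j : (2 ^+ k * q)`_j = 2 ^+ k * q`_j.
  by rewrite -[2]/(2%:R) -polyC_natr -rmorphXn /= coefCM.
have cX2 j : ('X - 2 ^+ e : {poly int})`_j = (j == 1%N)%:R - 2 ^+ e *+ (j == 0%N).
  rewrite coefB coefX; congr (_ - _).
  by rewrite -[2 ^+ e]mulr1 c2 coef1; case: (j == 0%N); rewrite ?mulr1 ?mulr0.
have v2top : v2 P`_(n - s) = Some e.
  have -> : P`_(n - s) = 2 ^+ e * (2 * E`_n - 1).
    by rewrite cE subnKC // coefD c2 coefXnM ltnn subnn cX2 /= exprS; ring.
  rewrite /v2 ifF ?logn2_oddM //; apply/negbTE.
  by rewrite mulf_neq0 ?expf_neq0 //; lia.
exists (n - s)%N; split=> //; rewrite v2top // => j jn.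
have -> : P`_j = 2 ^+ e.+1 * E`_(s + j).
  by rewrite cE coefD c2 coefXnM ifT ?add0r //; lia.
rewrite /val_lt /v2; case: eqVneq => //= nz; rewrite -ltnNge.
have E0 : E`_(s + j) != 0 by apply: contra nz => /eqP->; rewrite mulr0.
rewrite abszM lognM ?absz_gt0 ?expf_neq0 // abszX pfactorK //; lia.
Qed.

(** * The rescaled critical orbit and its 2-adic shape *)

Lemma comp_polyXn (R : comNzRingType) (p q : {poly R}) n :
  (p ^+ n) \Po q = (p \Po q) ^+ n.
Proof. exact: rmorphXn. Qed.

Lemma comp_poly_natr (R : comNzRingType) (q : {poly R}) n :
  n%:R \Po q = n%:R.
Proof. exact: rmorph_nat. Qed.

(** In a coordinate where [L] is 4c, the term of index i is 4^(2^i) a_(i+1). The exponent drops by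
    one because [L] already carries one factor 4. *)
Fixpoint scaled_orbit (L : {poly int}) (i : nat) : {poly int} :=
  if i is j.+1 then scaled_orbit L j ^+ 2 + 4 ^+ (2 ^ j.+1).-1 * L else L.

Lemma scaled_orbit_comp (L v l : {poly int}) i : L \Po v = 4 * l ->
  scaled_orbit L i \Po v = 4 ^+ (2 ^ i) * (a i.+1 \Po l).
Proof.
move=> eL; elim: i => [|i IHi].
  by rewrite expn0 expr1 crit_orbit1 comp_polyX.
rewrite [scaled_orbit L i.+1]/= crit_orbitS !comp_polyD comp_polyX.
rewrite [X in _ + X]comp_polyM !comp_polyXn comp_poly_natr IHi eL exprMn -exprM.
have : (2 ^ i.+1 = (2 ^ i.+1).-1.+1)%N by rewrite prednK // expn_gt0.
rewrite -expnSr; set N := (2 ^ i.+1).-1 => ->; rewrite exprS; ring.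
Qed.

Lemma exp2_split (R : nzRingType) k n : (k <= n)%N ->
  2 ^+ n = 2 ^+ k * 2 ^+ (n - k) :> R.
Proof. by move=> kn; rewrite -exprD subnKC. Qed.

(** Squaring doubles the subleading coefficient, which raises its valuation by one at each step. The
    parameter [s] lets the lemma serve both a linear [L] (s = 0) and a quadratic one (s = 1). *)
Lemma scaled_orbit_cong L E0 s i :
  scaled_orbit L 1 = 'X^((2 ^ s.+1).-1) * ('X - 2 ^+ 2) + 2 ^+ 3 * E0 ->
  exists E, scaled_orbit L i.+1 =
    'X^((2 ^ (s + i).+1).-1) * ('X - 2 ^+ i.+2) + 2 ^+ i.+3 * E.
Proof.
move=> e1; elim: i => [|i [E IHE]]; first by exists E0; rewrite addn0.
have -> : scaled_orbit L i.+2 =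
  scaled_orbit L i.+1 ^+ 2 + 4 ^+ (2 ^ i.+2).-1 * L by [].
rewrite IHE -[4 in X in _ + X]/((2 * 2)%:R) natrM -expr2 -exprM.
(* The added multiple of [L] is divisible by 2^(i+4), so it falls into the error term. *)
have le : (i.+4 <= 2 * (2 ^ i.+2).-1)%N by have := ltn_expl i.+2 (ltnSn 1); lia.
rewrite (exp2_split _ _ _ le).
have -> : ((2 ^ (s + i.+1).+1).-1 = (2 ^ (s + i).+1).-1 * 2 + 1)%N.
  by rewrite addnS (expnS 2 (s + i).+1); have := expn_gt0 2 (s + i).+1; lia.
set n := (2 ^ (s + i).+1).-1; set c := 2 ^+ (_ - _).
(* Expanding the square, the cross term -2^(i+3) X of (X - 2^(i+2))^2 gives the new subleading term;
   the rest is divided by 2^(i+4). *)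
exists (2 ^+ i * 'X^(n * 2) + E * 'X^n * ('X - 2 ^+ i.+2) + 2 ^+ i.+2 * E ^+ 2
  + c * L).
rewrite exprD exprM !exprS; ring.
Qed.

(** * Period one *)

Lemma misiurewicz1 i : exists G : {poly int},
  a i.+2 + a i.+1 = G * 'X /\ misiurewicz i.+2 1 = G.
Proof.
have /factor_theorem [G] : root (a i.+2 + a i.+1) 0.
  by rewrite rootE hornerD !crit_orbit_root0 addr0.
rewrite subr0 => eG; exists G; split=> //; apply: misiurewiczE.
(* Since 1 divides m - 1, the correction factor is always present and equals 1/a_1 = 1/c. *)
have -> : misiurewicz_frac i.+2 1 =
    (a i.+2 + a i.+1)%:F ^ 1 * (a 1)%:F ^ (- 1).
  rewrite /misiurewicz_frac /misiurewicz_eps dvd1n.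
  by rewrite !big_seq1 divnn /= addn1.
rewrite eG crit_orbit1 expr1z tofracM mulfK //.
by rewrite tofrac_eq0 polyX_eq0.
Qed.

Lemma size_monic_orbitD i :
  size (a i.+2 + a i.+1) = (2 ^ i.+1).+1 /\ a i.+2 + a i.+1 \is monic.
Proof.
have [s2 m2] := size_crit_orbit_monic i.+1.
have [s1 m1] := size_crit_orbit_monic i.
have lt : (size (a i.+1) < size (a i.+2))%N by rewrite s1 s2 !ltnS ltn_exp2l.
by rewrite size_polyDl // monicE lead_coefDl.
Qed.

(** The multiplier of a fixed point x is 2x, whence the substitution 2X. The sign makes A(X - X^2) +
    X monic, and the factor X restores the fixed point 0 at c = 0. *)
Lemma multiplier_polyC1 i (P : {poly int}) :
  ('X * P) \Po (2 * 'X) =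
    (-1) ^+ (2 ^ i) * 2 ^+ (2 ^ i.+1) * (a i.+1 \Po ('X - 'X^2) + 'X) ->
  toC P = multiplier_polyC i.+2 1 /\ size ('X * P) = (2 ^ i.+1).+1.
Proof.
move=> eP.
have [G [eG defG]] := misiurewicz1 i.
have [szF mF] := size_monic_orbitD i.
have mG : G \is monic by rewrite -(monicMr _ (monicX _)) -eG.
pose rs := 0 :: roots_seq (toC G).
pose A := toC (a i.+1).
pose h c := (toC (a i.+2)).[c].
have eF : toC (a i.+2 + a i.+1) = \prod_(c <- rs) ('X - c%:P).
  by rewrite eG rmorphM /= map_polyX (roots_seqE _ mG) big_cons subr0 mulrC.
have szrs : size rs = (2 ^ i.+1)%N.
  by apply: succn_inj; rewrite -szF -size_toC eF size_prod_XsubC.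
have hA c : c \in rs -> A.[c] = - h c.
  rewrite -root_prod_XsubC -eF rmorphD rootE hornerD addrC addr_eq0.
  by move/eqP.
have hc c : c \in rs -> h c - h c ^+ 2 = c.
  move=> /hA hAc; have : h c = A.[c] ^+ 2 + c := horner_crit_orbitS _ _.
  by rewrite hAc sqrrN => {1}->; rewrite addrC addKr.
pose S := \prod_(c <- rs) ('X - (h c)%:P).
pose T := A \Po ('X - 'X^2) + 'X.
have T1 : T \Po (1 - 'X) = A \Po ('X - 'X^2) + 1 - 'X.
  rewrite comp_polyD comp_polyX -comp_polyA comp_polyB comp_polyX rmorphXn /=.
  rewrite comp_polyX addrA; congr (_ \Po _ + _ - _); ring.
(* Both sides equal (a_m + a_(m-1))(X - X^2): for each root, X - X^2 - (h - h^2) = (X - h)(1 - X -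
   h). *)
have ST : S * (S \Po (1 - 'X)) = T * (T \Po (1 - 'X)).
  have -> : T * (T \Po (1 - 'X)) = toC (a i.+2 + a i.+1) \Po ('X - 'X^2).
    rewrite T1 /T rmorphD /= toC_crit_orbitS !comp_polyD comp_polyXn.
    by rewrite comp_polyX -/A; ring.
  rewrite eF /S !rmorph_prod /= -big_split /=; apply: eq_big_seq => c crs.
  rewrite !comp_polyB !comp_polyX !comp_polyC -{3}(hc c crs) polyCB rmorphXn /=.
  ring.
have cop : coprimep S (T \Po (1 - 'X)).
  rewrite coprimep_sym /S big_seq; elim/big_ind: _ => [|p q cp cq|c crs].
  - exact: coprimep1.
  - by rewrite coprimepMr cp.
  (* As A(c) = -h(c), the value of T(1 - X) at h(c) is 1 - 2 h(c). *)
  rewrite coprimep_XsubC rootE T1 !hornerE horner_comp !hornerE hc // hA //.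
  apply/negP => /eqP h0.
  have h2 : h c = 2^-1.
    apply: (mulfI (x := 2)); rewrite ?pnatr_eq0 // divff ?pnatr_eq0 //.
    by apply/esym/eqP; rewrite -subr_eq0; apply/eqP; rewrite -[RHS]h0; ring.
  have: 0 <= A.[c].
    apply: toC_crit_orbit_ge0; rewrite -(hc c crs) h2.
    have -> : 2^-1 - 2^-1 ^+ 2 = 4^-1 :> algC by field.
    by rewrite invr_ge0.
  by rewrite hA // h2 oppr_ge0 invr_le0 lern0.
have [sA mA] : size A = (2 ^ i).+1 /\ A \is monic.
  by rewrite size_toC toC_monic; apply: size_crit_orbit_monic.
have [sq lq] : size ('X - 'X^2 : {poly algC}) = 3 /\
    lead_coef ('X - 'X^2 : {poly algC}) = -1.
  have lt : (size ('X : {poly algC}) < size (- 'X^2 : {poly algC}))%N.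
    by rewrite size_polyN size_polyX size_polyXn.
  rewrite addrC size_polyDl // lead_coefDl // size_polyN lead_coefN size_polyXn.
  by rewrite lead_coefXn.
have sAq : size (A \Po ('X - 'X^2)) = (2 ^ i.+1).+1.
  have := size_comp_poly A ('X - 'X^2); rewrite sA sq /= -expnSr.
  case: (size _) => [|n] /= e; last by rewrite e.
  by have := expn_gt0 2 i.+1; rewrite -e.
have ltX : (size ('X : {poly algC}) < size (A \Po ('X - 'X^2)))%N.
  by rewrite sAq size_polyX ltnS expnS; have := expn_gt0 2 i; lia.
have mT : (-1) ^+ (2 ^ i) *: T \is monic.
  rewrite monicE lead_coefZ lead_coefDl // lead_coef_comp ?sq // lq sA.
  by rewrite (monicP mA) mul1r -expr2 sqrr_sign.
(* By coprimality S divides T; both are monic of the same size after the sign correction, so they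
   agree. *)
have dvd : S %| (-1) ^+ (2 ^ i) *: T.
  by rewrite dvdpZr ?signr_eq0 // -(Gauss_dvdpl _ cop) -ST dvdp_mulr.
have ES : S = (-1) ^+ (2 ^ i) *: T.
  apply/eqP; rewrite -eqp_monic ?monic_prod_XsubC // -dvdp_size_eqp //.
  by rewrite size_prod_XsubC szrs size_scale ?signr_eq0 // size_polyDl // sAq.
have main : \prod_(c <- rs) ('X - (2 * h c + 0)%:P) = toC ('X * P).
  apply: (prod_XsubC_affine _ rs h); first by rewrite pnatr_eq0.
  rewrite -/S ES szrs addr0 -!mul_polyC polyC_natr.
  have -> : 2 * 'X = toC (2 * 'X) :> {poly algC}.
    by rewrite rmorphM /= map_polyX rmorph_nat.
  rewrite -toC_comp eP !rmorphM rmorphD /= map_polyX toC_comp !rmorphXn /=.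
  rewrite !rmorphN1 rmorph_nat rmorphB rmorphXn /= map_polyX -/A -/T.
  by rewrite polyC_natr; ring.
split.
  have X0 : 'X != 0 :> {poly algC} by rewrite polyX_eq0.
  have h0 : h 0 = 0.
    have := horner_map (intr : {rmorphism int -> algC}) (a i.+2) 0.
    by rewrite rmorph0 crit_orbit_root0 rmorph0.
  apply: (mulfI X0); move: main; rewrite rmorphM /= map_polyX => <-.
  rewrite big_cons h0 mulr0 addr0 subr0 /multiplier_polyC defG; congr (_ * _).
  by apply: eq_bigr => c _; rewrite /multiplier big_ord1 addn0 expr1 addr0.
by rewrite -size_toC -main size_prod_XsubC szrs.
Qed.

Lemma scaled_orbit_root0 (L : {poly int}) i :
  L.[0] = 0 -> (scaled_orbit L i).[0] = 0.
Proof.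
by move=> L0; elim: i => //= i IHi; rewrite hornerD !hornerM IHi L0 !mulr0.
Qed.

Lemma two_special_multiplier1 i : two_special (multiplier_poly i.+2 1).
Proof.
have [P [E [e [e2 eP cP]]]] : exists (P E : {poly int}) (e : nat),
  [/\ (2 <= e)%N,
      'X^1 * P = 'X^((2 ^ i.+1).-1) * ('X - 2 ^+ e) + 2 ^+ e.+1 * E
    & ('X * P) \Po (2 * 'X) =
    (-1) ^+ (2 ^ i) * 2 ^+ (2 ^ i.+1) * (a i.+1 \Po ('X - 'X^2) + 'X)].
  case: i => [|i].
    (* The congruence for [scaled_orbit] starts at index 1, so this case is computed directly. *)
    exists ('X - 4), 0, 2%N; split=> //; first by rewrite /=; ring.
    rewrite crit_orbit1 comp_polyX comp_polyM comp_polyB comp_polyX.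
    by rewrite comp_poly_natr; ring.
  (* Replacing X by 2X turns [L] into 4(X - X^2), that is 4c for the fixed point X. *)
  pose L : {poly int} := 2 * 'X - 'X^2.
  pose K := scaled_orbit L i.+1.
  pose T := K + 2 ^+ (2 ^ i.+2).-1 * 'X.
  have /factor_theorem [P] : root T 0.
    by rewrite rootE hornerD hornerM hornerX mulr0 scaled_orbit_root0 //
      !hornerE.
  rewrite subr0 mulrC => eT.
  have [E eK] : exists E, K =
      'X^((2 ^ (1 + i).+1).-1) * ('X - 2 ^+ i.+2) + 2 ^+ i.+3 * E.
    by apply: (scaled_orbit_cong _ 'X); rewrite /= /L; ring.
  (* The summand X of A(X - X^2) + X, once rescaled, is also absorbed by the error term. *)
  have le : (i.+3 <= (2 ^ i.+2).-1)%N.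
    by rewrite expnS; have := ltn_expl i.+1 (ltnSn 1); lia.
  exists P, (E + 2 ^+ ((2 ^ i.+2).-1 - i.+3) * 'X), i.+2; split=> //.
    by rewrite expr1 -eT /T eK (exp2_split _ _ _ le) add1n; ring.
  rewrite -eT /T comp_polyD (scaled_orbit_comp _ _ ('X - 'X^2)); last first.
    rewrite comp_polyB comp_polyM comp_polyXn comp_polyX comp_poly_natr; ring.
  rewrite comp_polyM comp_polyX comp_polyXn comp_poly_natr.
  have -> : (-1) ^+ (2 ^ i.+1) = 1 :> {poly int}.
    by rewrite -signr_odd expnS oddM.
  have -> : 4 ^+ (2 ^ i.+1) = 2 ^+ (2 ^ i.+2) :> {poly int}.
    by rewrite (expnS 2 i.+1) exprM; congr (_ ^+ _); ring.
  have : (2 ^ i.+2 = (2 ^ i.+2).-1.+1)%N by rewrite prednK // expn_gt0.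
  by set N := (2 ^ i.+2).-1 => ->; rewrite exprS; ring.
have [tP szP] := multiplier_polyC1 i P cP.
rewrite (multiplier_polyE _ _ _ tP).
have N0 := expn_gt0 2 i; have eN := expnS 2 i.
apply: (two_special_cong P E 1 (2 ^ i.+1).-1 e) => //; last by lia.
- by rewrite -toC_monic tP monic_prod_XsubC.
- by rewrite expr1 szP prednK // expn_gt0.
Qed.

(** * Period two *)

Definition misiurewicz2_numer i : {poly int} := a i.+1 ^+ 2 - a i.+1 + 'X + 1.
Local Notation H := misiurewicz2_numer.

Lemma size_misiurewicz2_numer i : size (H i) = (2 ^ i.+1).+1 /\ H i \is monic.
Proof.
have [s2 m2] := size_crit_orbit_monic i.+1.
have [s1 m1] := size_crit_orbit_monic i.
have -> : H i = a i.+2 + (1 - a i.+1) by rewrite /H (crit_orbitS i.+1); ring.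
have lt : (size (1 - a i.+1)%R < size (a i.+2))%N.
  rewrite (leq_ltn_trans (size_polyD _ _)) // size_polyN size_poly1 s1 s2 gtn_max.
  by rewrite expnS; have := expn_gt0 2 i; lia.
by rewrite size_polyDl // monicE lead_coefDl.
Qed.

Lemma misiurewicz2_numer_rootN1 i : odd i -> (H i).[-1] = 0.
Proof. by move=> oi; rewrite /H !hornerE crit_orbit_rootN1 /= oi. Qed.

Lemma misiurewicz2 i G : ('X + 1) ^+ odd i * G = H i -> misiurewicz i.+2 2 = G.
Proof.
move=> eG; apply: misiurewiczE.
(* The correction factor occurs when m - 1 = i + 1 is even, i.e. i is odd; it is then a_1/a_2 = 1/(c
   + 1). *)
have -> : misiurewicz_frac i.+2 2 =
    (a i.+2 + a i.+1)%:F ^ (- 1) * (a i.+3 + a i.+1)%:F ^ 1 *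
    (if odd i then (a 1)%:F ^ 1 * (a 2)%:F ^ (- 1) else 1).
  rewrite /misiurewicz_frac /misiurewicz_eps dvdn2 /= negbK.
  by rewrite !big_cons !big_nil !mulr1 addn1 addn2.
(* A difference of squares: a_(m+1) - a_m = a_m^2 - a_(m-1)^2 contains the factor a_m + a_(m-1). *)
have -> : a i.+3 + a i.+1 = (a i.+2 + a i.+1) * H i.
  by rewrite /H !(crit_orbitS i.+2) !(crit_orbitS i.+1); ring.
have [_ mF] := size_monic_orbitD i.
rewrite !expr1z tofracM mulKf ?tofrac_eq0 ?monic_neq0 //.
rewrite -eG; case: (odd i); last by rewrite mul1r mulr1.
have -> : a 2 = 'X * ('X + 1) by rewrite crit_orbitS crit_orbit1; ring.
rewrite crit_orbit1 expr1 exprN1 !tofracM invfM.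
have X0 : ('X)%:F != 0 by rewrite tofrac_eq0 polyX_eq0.
have X1 : ('X + 1)%:F != 0.
  by rewrite tofrac_eq0 monic_neq0 // -[1]opprK -polyCN monicXsubC.
move: ('X%:F) (('X + 1)%:F) (G%:F) X0 X1 => x y g x0 y0.
by rewrite mulVKf ?x0 // mulrAC divff ?y0 // mul1r.
Qed.

Lemma multiplier_polyC2 i (G P : {poly int}) :
  ('X + 1) ^+ odd i * G = H i ->
  P \Po (4 * 'X + 4) = 4 ^+ (size G).-1 * G ->
  toC P = multiplier_polyC i.+2 2 /\ size P = size G.
Proof.
move=> eG eP.
have mX1 : 'X + 1 \is @monic int by rewrite -[1]opprK -polyCN monicXsubC.
have mG : G \is monic.
  have [_] := size_misiurewicz2_numer i.
  by rewrite -eG monicMl // rpredX.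
rewrite /multiplier_polyC (misiurewicz2 _ _ eG).
set rs := roots_seq _.
have eGrs : toC G = \prod_(c <- rs) ('X - c%:P) by apply: roots_seqE.
have eP4 : \prod_(c <- rs) ('X - (4 * c + 4)%:P) = toC P.
  apply: (prod_XsubC_affine _ rs id); first by rewrite pnatr_eq0.
  rewrite /= -eGrs -!mul_polyC !polyC_natr.
  have -> : 4 * 'X + 4 = toC (4 * 'X + 4) :> {poly algC}.
    by rewrite rmorphD rmorphM /= map_polyX !rmorph_nat.
  rewrite -toC_comp eP rmorphM rmorphXn /= rmorph_nat.
  by rewrite -size_toC eGrs size_prod_XsubC /= rmorphXn /= polyC_natr.
split; last by rewrite -!size_toC -eP4 eGrs !size_prod_XsubC.
rewrite -eP4; apply: eq_big_seq => c; rewrite -root_prod_XsubC -eGrs => Gc.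
congr ('X - _%:P).
have : root (toC (H i)) c by rewrite -eG rmorphM rootM Gc orbT.
rewrite /H !rmorphD rmorphN rmorphXn rmorph1 /= map_polyX rootE !hornerE.
rewrite /multiplier !big_ord_recl big_ord0 /= addn0 addn1.
rewrite (horner_crit_orbitS i.+2) (horner_crit_orbitS i.+1).
set x := (toC (a i.+1)).[c] => /eqP Hc.
(* With x = a_(m-1)(c), the cycle is x - 1, -x, with product x - x^2 = c + 1. *)
have ex2 : x ^+ 2 = x - c - 1.
  by apply/eqP; rewrite -subr_eq0 -Hc; apply/eqP; ring.
have ey : x ^+ 2 + c = x - 1 by rewrite ex2; ring.
have ez : (x - 1) ^+ 2 + c = - x.
  have -> : (x - 1) ^+ 2 = x ^+ 2 - 2 * x + 1 by ring.
  by rewrite ex2; ring.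
rewrite ey ez; transitivity (4 * (x - x ^+ 2)); last by ring.
by rewrite ex2; ring.
Qed.

(** Allows both parities of i to be handled at once, a factor being split off only when i is odd. *)
Lemma factor_theorem_if (p : {poly int}) (b : bool) (x : int) : (b -> p.[x] = 0) ->
  exists q, ('X - x%:P) ^+ b * q = p.
Proof.
case: b => [/(_ isT)/eqP px|_]; last by exists p; rewrite expr0 mul1r.
by have /factor_theorem [q ->] := px; exists q; rewrite expr1 mulrC.
Qed.

Lemma two_special_multiplier2 i : two_special (multiplier_poly i.+2 2).
Proof.
(* The variable is now the multiplier 4c + 4, so X - 4 is 4c; [T] below is the numerator [H]
   rescaled in this variable. *)
pose B := scaled_orbit ('X - 4) i.
pose T := B ^+ 2 - 4 ^+ (2 ^ i) * B + 4 ^+ (2 ^ i.+1).-1 * 'X.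
have [E [e [e2 eT]]] : exists (E : {poly int}) (e : nat), (2 <= e)%N /\
  T = 'X^((2 ^ i.+1).-1) * ('X - 2 ^+ e) + 2 ^+ e.+1 * E.
  rewrite /T /B; case: (i) => [|j]; first by exists 2, 3%N; split=> //=; ring.
  have [E eB] := scaled_orbit_cong ('X - 4) 0 0 j
    ltac:(by rewrite /=; ring).
  rewrite eB add0n.
  (* The two terms of [T] other than the square of [B] are divisible by 2^(j+4), so only the square
     matters. *)
  have le1 : (j.+4 <= 2 * 2 ^ j.+1)%N.
    by rewrite -expnS; have := ltn_expl j.+1 (ltnSn 1); rewrite !expnS; lia.
  have le2 : (j.+4 <= 2 * (2 ^ j.+2).-1)%N.
    by have := ltn_expl j.+2 (ltnSn 1); lia.
  have e4 n : 4 ^+ n = 2 ^+ (2 * n) :> {poly int}.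
    by rewrite exprM; congr (_ ^+ _); ring.
  rewrite !e4 (exp2_split _ _ _ le1) (exp2_split _ _ _ le2).
  have -> : ((2 ^ j.+2).-1 = (2 ^ j.+1).-1 * 2 + 1)%N.
    by rewrite (expnS 2 j.+1); have := expn_gt0 2 j.+1; lia.
  set n := (2 ^ j.+1).-1; set c1 := 2 ^+ (_ - _); set c2 := 2 ^+ (_ - _).
  exists (2 ^+ j * 'X^(n * 2) + E * 'X^n * ('X - 2 ^+ j.+2) + 2 ^+ j.+2 * E ^+ 2
    - c1 * ('X^n * ('X - 2 ^+ j.+2) + 2 ^+ j.+3 * E) + c2 * 'X), j.+3.
  by split=> //; rewrite exprD exprM !exprS; ring.
have cT : T \Po (4 * 'X + 4) = 4 ^+ (2 ^ i.+1) * H i.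
  have cB : B \Po (4 * 'X + 4) = 4 ^+ (2 ^ i) * a i.+1.
    rewrite (scaled_orbit_comp _ _ 'X) ?comp_polyXr //.
    by rewrite comp_polyB comp_polyX comp_poly_natr; ring.
  rewrite /T comp_polyD comp_polyB comp_polyXn !comp_polyM !comp_polyXn.
  rewrite comp_polyX.
  rewrite comp_poly_natr cB exprMn -exprM -expnSr /H.
  have : (2 ^ i.+1 = (2 ^ i.+1).-1.+1)%N by rewrite prednK // expn_gt0.
  have : 4 ^+ (2 ^ i) * 4 ^+ (2 ^ i) = 4 ^+ (2 ^ i.+1) :> {poly int}.
    by rewrite -exprD addnn -mul2n -expnS.
  set N := (2 ^ i.+1).-1; set q := 4 ^+ (2 ^ i) => eq eN.
  rewrite [q * (q * _)]mulrA eq eN exprS; ring.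
have H1 : odd i -> (H i).[-1] = 0 by exact: misiurewicz2_numer_rootN1.
have [G] := factor_theorem_if _ _ _ H1; rewrite polyCN opprK => eG.
(* The point c = -1 corresponds to multiplier 0, so the factor c + 1 of [H] becomes a factor X of
   [T]. *)
have T0 : odd i -> T.[0] = 0.
  move=> oi; have := congr1 (horner^~ (-1)) cT.
  have -> : forall p : {poly int}, (p \Po (4 * 'X + 4)).[-1] = p.[0].
    by move=> p; rewrite horner_comp -polyC_natr !hornerE.
  by rewrite hornerM H1 // mulr0.
have [P] := factor_theorem_if _ _ _ T0; rewrite subr0 => eP.
have mX1 : 'X + 1 \is @monic int by rewrite -[1]opprK -polyCN monicXsubC.
have [szH mH] := size_misiurewicz2_numer i.
have szG : (odd i + (size G).-1 = 2 ^ i.+1)%N.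
  have sX1 : size (('X + 1 : {poly int}) ^+ odd i) = (odd i).+1.
    by case: (odd i); rewrite ?expr0 ?size_poly1 // expr1 size_XaddC.
  have nG : G != 0.
    by apply: contra_eqN eG => /eqP ->; rewrite mulr0 eq_sym monic_neq0.
  apply: succn_inj; rewrite -szH -eG size_monicM ?rpredX // sX1.
  by rewrite -size_poly_gt0 in nG; rewrite addSn -addnS prednK.
have cP : P \Po (4 * 'X + 4) = 4 ^+ (size G).-1 * G.
  have e4 : 4 * 'X + 4 = 4 * ('X + 1) :> {poly int} by ring.
  have q0 : (4 * 'X + 4 : {poly int}) ^+ odd i != 0.
    rewrite expf_neq0 // e4 mulf_neq0 //.
      by rewrite -polyC_natr polyC_eq0.
    exact: monic_neq0.
  (* Cancelling the power of 4X + 4 on both sides of [cT] leaves the relation between [P] and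
     [G]. *)
  apply: (mulfI q0); have := cT.
  rewrite -eP comp_polyM comp_polyXn comp_polyX => ->.
  by rewrite -eG -szG exprD e4 exprMn; ring.
have [tP szP] := multiplier_polyC2 i G P eG cP.
rewrite (multiplier_polyE _ _ _ tP).
have mP : P \is monic by rewrite -toC_monic tP monic_prod_XsubC.
have N0 := expn_gt0 2 i; have eN := expnS 2 i.
apply: (two_special_cong P E (odd i) (2 ^ i.+1).-1 e) => //.
- rewrite size_monicM ?monicXn ?monic_neq0 // size_polyXn szP.
  have G0 : (0 < size G)%N by rewrite -szP size_poly_gt0 monic_neq0.
  by rewrite prednK ?expn_gt0 // -szG addSn /= -addnS prednK.
- by case: (odd i) => /=; lia.
- by rewrite eP.
Qed.

End MultiplierPolynomials.

Theorem theorem7p2 (m : nat) (hm : 2 <= m) :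
  two_special (multiplier_poly m 1) /\ two_special (multiplier_poly m 2).
Proof.
case: m hm => [|[|i]] // _; split.
  exact: two_special_multiplier1.
exact: two_special_multiplier2.
Qed.
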